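(* Let $a\in\mathbb{R}$, let $1<\nu<2$, and let $f:\mathbb{N}_{a-1}\to\mathbb{R}$. Assume that $\nabla_{a-1}^{\nu} f(t)\ge 0$ for each $t\in\mathbb{N}_{a+2}$. If $$f(a+1)\ge \frac{\nu}{k+2}\,f(a)\quad\text{for each } k\in\mathbb{N}_0,$$ then $\nabla f(t)\ge 0$ for all $t\in\mathbb{N}_{a+2}$.
   Context: For a real number $c$, $\mathbb{N}_c=\{c,c+1,c+2,\dots\}$. $\nabla f(t)=f(t)-f(t-1)$, $\nabla^m=\nabla(\nabla^{m-1})$, $\rho(s)=s-1$. The rising function is $x^{\overline{\beta}}=\Gamma(x+\beta)/\Gamma(x)$. The nabla left fractional sum of order $\beta>0$ starting from $c$ is $\nabla_c^{-\beta}f(t)=\frac{1}{\Gamma(\beta)}\sum_{s=c+1}^{t}(t-\rho(s))^{\overline{\beta-1}}f(s)$, with empty sums equal to $0$. The nabla left (Riemann) fractional difference of noninteger order $\nu>0$ starting from $c$, with $n=[\nu]+1$ ($[\nu]$ the integer part), is $\nabla_c^{\nu}f(t)=\nabla^n\nabla_c^{-(n-\nu)}f(t)$ for $t\in\mathbb{N}_{c+1}$; equivalently, $\nabla_c^{\nu}f(t)=\frac{1}{\Gamma(-\nu)}\sum_{s=c+1}^{t}(t-\rho(s))^{\overline{-\nu-1}}f(s)$ for $t\in\mathbb{N}_{c+1}$. Here it is used with $c=a-1$. *)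

(* Defs.v *)
From mathcomp Require Import all_boot all_order all_algebra.
From mathcomp Require Import all_classical all_reals all_analysis.
Import Order.TTheory GRing.Theory Num.Theory.
Import numFieldNormedType.Exports.

Set Implicit Arguments.
Unset Strict Implicit.
Unset Printing Implicit Defensive.

Local Open Scope classical_set_scope.
Local Open Scope ring_scope.

Definition Euler_integral {R : realType} (x : R) : R :=
  \int[@lebesgue_measure R]_(t in `]0, +oo[) (t `^ (x - 1) * expR (- t)).

(* Outside x > 0 this is the extension by Gamma (x + 1) = x * Gamma x, with n
   the number of steps needed to reach a positive argument.  At the poles
   0, -1, -2, ... the product vanishes, so Gamma takes the value 0 there, and
   1 / Gamma vanishes as it should. *)
Definition Gamma {R : realType} (x : R) : R :=
  if 0 < x then Euler_integral x
  else let n := (Num.truncn (- x)).+1 in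
       Euler_integral (x + n%:R) / \prod_(i < n) (x + i%:R).

Definition rising {R : realType} (x beta : R) : R :=
  Gamma (x + beta) / Gamma x.

Definition NN {R : realType} (c : R) : set R := range (fun n : nat => c + n%:R).

(* A function on NN c is represented by a total function on R, of which only
   the values on NN c are used. *)
Definition nabla {R : realType} (f : R -> R) : R -> R :=
  fun t => f t - f (t - 1).

Definition rho {R : realType} (s : R) : R := s - 1.

(* The sum of F s over s = c + 1, c + 2, ..., t for t in c + Z.  As truncn is 0
   on negative numbers, it is empty when t < c + 1. *)
Definition sum_upto {R : realType} (c t : R) (F : R -> R) : R :=
  \sum_(i < Num.truncn (t - c)) F (c + i.+1%:R).

Definition nabla_sum {R : realType} (c beta : R) (f : R -> R) : R -> R :=
  fun t => (Gamma beta)^-1 *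
    sum_upto c t (fun s => rising (t - rho s) (beta - 1) * f s).

(* For nu positive and not an integer. *)
Definition nabla_diff {R : realType} (c nu : R) (f : R -> R) : R -> R :=
  let n := (Num.truncn nu).+1 in
  iter n nabla (nabla_sum c (n%:R - nu) f).

(* Main.v *)
(* The nabla difference of order nu at a + n is the convolution of f with the
   coefficients of (1 - z)^nu.  This rests on the functional equation of Gamma,
   by which the kernel of the nabla sum of order b has as entries the
   coefficients (b)_j / j! of (1 - z)^(-b), each nabla then lowering b by 1.
   Summation by parts replaces f by its increments d_j and the kernel by the
   coefficients e_j of (1 - z)^(nu - 1), which satisfy e_0 = 1 and e_j <= 0
   for j >= 1.  The sign condition at n + 2 becomes
     d_(n+2) >= - sum_(2 <= j <= n+1) e_(n+2-j) d_j
                - e_(n+1) (f (a + 1) - nu / (n + 2) f a),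
   so strong induction on n gives d_(n+2) >= 0. *)
Require Import Defs.
From mathcomp Require Import all_boot all_order all_algebra.
From mathcomp Require Import all_classical all_reals all_analysis.
From mathcomp Require Import measurable_realfun.
From mathcomp Require Import ring lra.
Import Order.TTheory GRing.Theory Num.Theory.
Import numFieldNormedType.Exports.
Local Open Scope classical_set_scope.
Local Open Scope ring_scope.

(** * Euler's integral: functional equation, finiteness and positivity for positive arguments *)

Section gamma.
Context {R : realType}.
Implicit Types x t : R.
Local Notation mu := (@lebesgue_measure R).

Definition Gamma_integrand x t : R := t `^ (x - 1) * expR (- t).

(** Kept in the extended reals, so that limits and the functional equation can be stated before
    finiteness is known. *)
Definition Gamma_integral x : \bar R :=
  (\int[mu]_(t in `]0%R, +oo[) (Gamma_integrand x t)%:E)%E.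

(** Compact intervals that avoid 0, where the integrand may be singular; the shifted indices make
    even the first one nondegenerate. *)
Definition exhaust (n : nat) : set R := `[n.+1%:R^-1, n.+2%:R]%classic.

Lemma Gamma_integrand_ge0 x t : 0 <= Gamma_integrand x t.
Proof. by rewrite mulr_ge0 ?powR_ge0 ?expR_ge0. Qed.

Lemma measurable_Gamma_integrand x (A : set R) :
  measurable_fun A (Gamma_integrand x).
Proof.
apply: measurable_funTS; apply: measurable_funM.
  by apply: (measurableT_comp (measurable_powR _)).
by apply: measurableT_comp => //; exact: measurable_funN.
Qed.

Lemma continuous_powR_gt0 p t : 0 < t -> {for t, continuous (@powR R ^~ p)}.
Proof.
move=> t0; apply: differentiable_continuous; apply/derivable1_diffP.
by apply: derivable_powR; rewrite in_itv/= t0.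
Qed.

Lemma continuous_expRN : continuous (fun t : R => expR (- t)).
Proof.
move=> t; apply: (@continuous_comp _ _ _ -%R expR).
  exact: opp_continuous.
exact: continuous_expR.
Qed.

Lemma is_derive_opp_expRN t :
  is_derive t (1 : R) (fun s : R => - expR (- s)) (expR (- t)).
Proof. by apply: is_derive_eq; rewrite mulrN1 opprK. Qed.

Lemma bigcup_exhaust : \bigcup_n exhaust n = `]0%R, +oo[%classic :> set R.
Proof.
apply/seteqP; split => [t [n _]|t]; rewrite /exhaust /= !in_itv/=.
  by move=> /andP[+ _]; rewrite andbT; apply: lt_le_trans; rewrite invr_gt0.
rewrite andbT => t0; exists (Num.truncn (Num.max t t^-1)) => //=.
rewrite /exhaust /= in_itv /=.
set n := Num.truncn _.
have h : Num.max t t^-1 < n.+1%:R by exact: truncnS_gt.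
have := h; rewrite gt_max => /andP[h1 h2].
apply/andP; split; last by rewrite (le_trans (ltW h1))// ler_nat.
by rewrite invf_ple ?posrE // ltW.
Qed.

Lemma nondecreasing_exhaust : nondecreasing_seq exhaust.
Proof.
move=> m n mn; rewrite subsetEset; apply: subset_itv; rewrite bnd_simp.
  by rewrite lef_pV2 ?posrE// ler_nat.
by rewrite ler_nat.
Qed.

Lemma Gamma_integral_cvg x :
  (\int[mu]_(t in exhaust n) (Gamma_integrand x t)%:E)%E @[n --> \oo]
    --> Gamma_integral x.
Proof.
rewrite /Gamma_integral -bigcup_exhaust.
apply: ge0_nondecreasing_set_cvg_integral.
- exact: nondecreasing_exhaust.
- by move=> i; exact: measurable_itv.
- by move=> i; apply/measurable_EFinP; exact: measurable_Gamma_integrand.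
- by move=> i t _; rewrite lee_fin Gamma_integrand_ge0.
Qed.

Lemma Gamma_integrand_cvg0 x : 0 < x ->
  Gamma_integrand (x + 1) n.+1%:R^-1 @[n --> \oo] --> (0 : R).
Proof.
move=> x0; apply: (@squeeze_cvgr _ _ _ _ (fun=> 0) (fun n => n.+1%:R^-1 `^ x)).
- near=> n; rewrite Gamma_integrand_ge0 /Gamma_integrand addrK /=.
  by rewrite ler_piMr ?powR_ge0// -expR0 ler_expR oppr_le0.
- exact: cvg_cst.
- apply: (@cvg_comp _ _ _ (fun n : nat => (n.+1%:R^-1 : R)) (@powR R ^~ x) _ (0^'+)).
    move=> A /= ; rewrite /at_right /within/= => hA.
    have := @cvg_harmonic R _ hA; rewrite /= /nbhs /=.
    apply: filterS => n /=; apply; rewrite invr_gt0//.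
  exact: powR_cvg0.
Unshelve. all: by end_near. Qed.

Lemma Gamma_integrand_cvgy x :
  Gamma_integrand x n.+2%:R @[n --> \oo] --> (0 : R).
Proof.
pose k := (Num.truncn `|x - 1|).+1.
have xk : x - 1 <= k%:R by apply: le_trans (ler_norm _) _; rewrite ltW// truncnS_gt.
(* The exponential series gives t^(k+1) / (k+1)! <= e^t, and t^(x-1) <= t^k for t >= 1, whence the
   bound (k+1)! / t. *)
apply: (@squeeze_cvgr _ _ _ _ (fun=> 0) (fun n => (k.+1)`!%:R * n.+2%:R^-1)).
- near=> n; rewrite Gamma_integrand_ge0 /Gamma_integrand /=.
  set t : R := n.+2%:R.
  have t1 : 1 <= t by rewrite ler1n.
  have t0 : 0 < t by rewrite ltr0n.
  have f0 : 0 < (k.+1)`!%:R :> R by rewrite ltr0n fact_gt0.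
  rewrite expRN ler_pdivrMr ?expR_gt0//.
  apply: (@le_trans _ _ (t ^+ k)).
    rewrite -powR_mulrn ?(ltW t0)//. exact: ler_powR.
  have := expR_ge1Dxn k (ltW t0).
  move=> h; have {}h : t ^+ k.+1 / (k.+1)`!%:R <= expR t by lra.
  rewrite ler_pdivrMr// in h.
  rewrite -(ler_pM2r t0) -exprSr; apply: (le_trans h).
  by rewrite (mulrAC _ _ t) divfK ?gt_eqF// mulrC.
- exact: cvg_cst.
- rewrite -[X in _ --> X](mulr0 (k.+1)`!%:R); apply: cvgMr.
  by have := @cvg_harmonic R; rewrite -(cvg_shiftS _).
Unshelve. all: by end_near. Qed.

(** Integration by parts of t^x against the primitive -e^(-t); the bracket holds the two boundary
    terms. *)
Lemma Gamma_integral_exhaustS x n :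
  (\int[mu]_(t in exhaust n) (Gamma_integrand (x + 1) t)%:E =
   (Gamma_integrand (x + 1) n.+1%:R^-1 - Gamma_integrand (x + 1) n.+2%:R)%:E
   + x%:E * \int[mu]_(t in exhaust n) (Gamma_integrand x t)%:E)%E.
Proof.
have lt0 : 0 < (n.+1%:R^-1 : R) by rewrite invr_gt0.
have ab : (n.+1%:R^-1 : R) < n.+2%:R.
  by rewrite (@le_lt_trans _ _ 1) ?invf_le1 ?ler1n ?ltr1n.
have gt0 t : t \in `[n.+1%:R^-1, n.+2%:R] -> 0 < t.
  by rewrite in_itv/= => /andP[+ _]; apply: lt_le_trans.
have dG := is_derive_opp_expRN.
have := @integration_by_parts R (@powR R ^~ x) (fun t => - expR (- t))
  (fun t => x * t `^ (x - 1)) (fun t => expR (- t)) _ _ ab.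
rewrite /Gamma_integrand addrK.
move=> ->.
- under eq_integral do rewrite mulrN mulrAC -mulrA -mulNr EFinM.
  rewrite integralZl//; last first.
    apply: continuous_compact_integrable; first exact: segment_compact.
    apply: continuous_in_subspaceT => t /set_mem/gt0 t0.
    by apply: cvgM; [exact: continuous_expRN | exact: continuous_powR_gt0].
  rewrite EFinN mulNe oppeK; congr (_ + _)%E.
    by congr EFin; rewrite !mulrN opprK addrC.
  by congr (_ * _)%E; apply: eq_integral => t _; rewrite mulrC.
- apply: continuous_in_subspaceT => t /set_mem/gt0 t0.
  by apply: cvgM; [exact: cvg_cst | exact: continuous_powR_gt0].
- split.
  + move=> t; rewrite in_itv/= => /andP[t0 _]; apply: derivable_powR.
    by rewrite in_itv/= (lt_trans lt0).
  + apply: cvg_at_right_filter; exact: continuous_powR_gt0.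
  + by apply: cvg_at_left_filter; apply: continuous_powR_gt0; rewrite ltr0n.
- move=> t; rewrite in_itv/= => /andP[t0 _]; rewrite powR_derive1//.
  by rewrite in_itv/= (lt_trans lt0).
- exact: continuous_subspaceT continuous_expRN.
- split.
  + by move=> t _; apply: ex_derive.
  + by apply: cvg_at_right_filter; apply: cvgN; exact: continuous_expRN.
  + by apply: cvg_at_left_filter; apply: cvgN; exact: continuous_expRN.
- by move=> t _; rewrite derive1E; apply: derive_val.
Qed.

(** The boundary terms tend to 0. As this limit is finite, the sum of limits makes sense even if the
    integral were infinite. *)
Lemma Gamma_integralS x : 0 < x ->
  Gamma_integral (x + 1) = (x%:E * Gamma_integral x)%E.
Proof.
move=> x0; rewrite -(cvg_lim _ (Gamma_integral_cvg (x + 1)))//.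
rewrite (funext (Gamma_integral_exhaustS x)); apply/cvg_lim => //.
rewrite -[(x%:E * Gamma_integral x)%E]add0e; apply: cvgeD.
- by rewrite fin_num_adde_defr.
- apply: cvg_EFin; first by near=> n.
  rewrite -[X in _ --> X](subr0 0); apply: cvgB.
    exact: Gamma_integrand_cvg0.
  exact: Gamma_integrand_cvgy.
- by apply: cvgeZl => //; exact: Gamma_integral_cvg.
Unshelve. all: by end_near. Qed.

Lemma Gamma_integral1 : Gamma_integral 1 = 1%E.
Proof.
rewrite /Gamma_integral.
under eq_integral do rewrite /Gamma_integrand subrr powRr0 mul1r.
rewrite integral_itv_obnd_cbnd//; last first.
  apply: measurableT_comp => //; apply: measurable_funTS.
  by apply: measurableT_comp => //; exact: measurable_funN.
have dG := is_derive_opp_expRN.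
rewrite (@ge0_continuous_FTC2y _ _ (fun t => - expR (- t)) _ 0).
- by rewrite oppr0 expR0 EFinN oppeK add0e.
- by move=> t _; exact: expR_ge0.
- exact: continuous_subspaceT continuous_expRN.
- by rewrite -oppr0; apply: cvgN; exact: cvgr_expR.
- by move=> t _; exact: ex_derive.
- by apply: cvg_at_right_filter; apply: cvgN; exact: continuous_expRN.
- by move=> t _; rewrite derive1E; apply: derive_val.
Qed.

Lemma Gamma_integral_ge0 x : (0 <= Gamma_integral x)%E.
Proof. by apply: integral_ge0 => t _; rewrite lee_fin Gamma_integrand_ge0. Qed.

(** By comparison with integer arguments, which are finite by induction from [Gamma_integral1]. *)
Lemma Gamma_integral_fin_num x : 0 < x -> Gamma_integral x \is a fin_num.
Proof.
move=> x0.
have finN n : Gamma_integral n.+1%:R \is a fin_num.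
  elim: n => [|n IHn]; first by rewrite Gamma_integral1.
  by rewrite -natr1 Gamma_integralS ?ltr0n// fin_numM.
(* The functional equation moves the exponent above 0, where t^x <= 1 + t^n. *)
suff : (Gamma_integral (x + 1) < +oo)%E.
  rewrite Gamma_integralS//; have := Gamma_integral_ge0 x.
  by case: (Gamma_integral x) => [r| |]//= _; rewrite gt0_muley ?lte_fin.
pose n := (Num.truncn x).+1.
apply: (@le_lt_trans _ _ (Gamma_integral 1 + Gamma_integral n.+1%:R)%E).
  rewrite /Gamma_integral -ge0_integralD//=; first last.
  - by apply/measurable_EFinP; exact: measurable_Gamma_integrand.
  - by move=> t _; rewrite lee_fin Gamma_integrand_ge0.
  - by apply/measurable_EFinP; exact: measurable_Gamma_integrand.
  - by move=> t _; rewrite lee_fin Gamma_integrand_ge0.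
  apply: ge0_le_integral => //=.
  - by move=> t _; rewrite lee_fin Gamma_integrand_ge0.
  - by apply/measurable_EFinP; exact: measurable_Gamma_integrand.
  - by apply/measurable_EFinP; apply: measurable_funD; exact: measurable_Gamma_integrand.
  move=> t; rewrite in_itv/= andbT => t0; rewrite lee_fin /Gamma_integrand.
  rewrite addrK subrr powRr0 -natr1 addrK -mulrDl ler_wpM2r ?expR_ge0//.
  have [t1|/ltW t1] := leP t 1.
    rewrite (@le_trans _ _ 1) ?lerDl ?powR_ge0//.
    by rewrite -[leRHS](powRr0 (t : R)); apply: ger_powR; rewrite ?t0 ?t1 ?ltW.
  rewrite (@le_trans _ _ (t `^ n%:R)) ?lerDr//.
  by apply: ler_powR => //; rewrite ltW// truncnS_gt.
by rewrite lte_add_pinfty// ltey_eq ?Gamma_integral1 ?finN.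
Qed.

(** At x + 1 the integrand is at least e^(-2) on [1, 2], since t^x >= 1 there; the functional
    equation carries positivity back to x. *)
Lemma Gamma_integral_gt0 x : 0 < x -> (0 < Gamma_integral x)%E.
Proof.
move=> x0; suff : (0 < Gamma_integral (x + 1))%E.
  rewrite Gamma_integralS//; have := Gamma_integral_ge0 x.
  by rewrite le_eqVlt => /predU1P[<-|//]; rewrite mule0 ltxx.
apply: (@lt_le_trans _ _ (\int[mu]_(t in `[1%R, 2%R]) (expR (- 2))%:E)%E).
  rewrite integral_cst//= lebesgue_measure_itv/= lte_fin ltr1n -EFinD -EFinM.
  by rewrite lte_fin mulr_gt0 ?expR_gt0// subr_gt0 ltr1n.
apply: (@le_trans _ _ (\int[mu]_(t in `[1%R, 2%R]) (Gamma_integrand (x + 1) t)%:E)%E).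
  apply: ge0_le_integral => //=.
  - by apply/measurable_EFinP; exact: measurable_Gamma_integrand.
  move=> t; rewrite in_itv/= => /andP[t1 t2]; rewrite lee_fin /Gamma_integrand addrK.
  rewrite -[leLHS]mul1r ler_pM ?expR_ge0//; last by rewrite ler_expR lerN2.
  by rewrite -(powRr0 t) ler_powR// ltW.
apply: ge0_subset_integral => //=.
- by apply/measurable_EFinP; exact: measurable_Gamma_integrand.
- by move=> t _; rewrite lee_fin Gamma_integrand_ge0.
- by move=> t; rewrite /= !in_itv/= andbT => /andP[t1 _]; exact: lt_le_trans t1.
Qed.

Lemma GammaE x : 0 < x -> Gamma x = fine (Gamma_integral x).
Proof. by move=> x0; rewrite /Gamma x0. Qed.

Lemma Gamma1 : Gamma (1 : R) = 1.
Proof. by rewrite GammaE// Gamma_integral1. Qed.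

Lemma Gamma_gt0 x : 0 < x -> 0 < Gamma x.
Proof.
move=> x0; rewrite GammaE// fine_gt0// Gamma_integral_gt0//.
by rewrite ltey_eq Gamma_integral_fin_num.
Qed.

Lemma GammaS x : 0 < x -> Gamma (x + 1) = x * Gamma x.
Proof.
move=> x0; rewrite !GammaE ?addr_gt0// Gamma_integralS// fineM//.
exact: Gamma_integral_fin_num.
Qed.

End gamma.

(** * Convolution with the coefficients of (1 - z)^(-b), and its link to the nabla operators *)

Section binomial_convolution.
Context {R : realType}.
Implicit Types (b nu : R) (F : nat -> R).

(* The coefficient of z^j in (1 - z)^(-b). *)
Definition bincoef b (j : nat) : R := \prod_(i < j) ((b + i%:R) / i.+1%:R).

Definition conv (u F : nat -> R) (n : nat) : R :=
  \sum_(i < n.+1) u (n - i)%N * F i.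

Lemma bincoefS b j : bincoef b j.+1 = bincoef b j * ((b + j%:R) / j.+1%:R).
Proof. by rewrite /bincoef big_ord_recr. Qed.

Lemma bincoef0 b : bincoef b 0 = 1.
Proof. by rewrite /bincoef big_ord0. Qed.

(** From j to j + 1 both sides gain the factor (b + j) / (j + 1). Positivity of b keeps every
    argument of [Gamma] positive, where [GammaS] applies. *)
Lemma bincoef_Gamma b j : 0 < b ->
  bincoef b j = (Gamma b)^-1 * rising j.+1%:R (b - 1).
Proof.
move=> b0; rewrite /rising.
have -> : j.+1%:R + (b - 1) = b + j%:R by rewrite -natr1; ring.
elim: j => [|j IHj].
  by rewrite bincoef0 addr0 mulrA mulVf ?mul1r ?gt_eqF ?Gamma_gt0// Gamma1 invr1.
rewrite bincoefS IHj.
have -> : b + j.+1%:R = b + j%:R + 1 by rewrite -natr1; ring.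
rewrite -(natr1 j.+1) !GammaS ?ltr0n// ?ltr_wpDr//.
have g1 : Gamma b != 0 by rewrite gt_eqF// Gamma_gt0.
have g2 : Gamma (j.+1%:R : R) != 0 by rewrite gt_eqF// Gamma_gt0.
have g3 : (j.+1%:R : R) != 0 by rewrite gt_eqF.
by field; rewrite g1 g2 addrC natr1 g3.
Qed.

(** Coefficient form of (1 - z)^(1 - b) = (1 - z) (1 - z)^(-b). *)
Lemma bincoef_pred b j :
  bincoef (b - 1) j.+1 = bincoef b j.+1 - bincoef b j.
Proof.
elim: j => [|j IHj].
  by rewrite !bincoefS !bincoef0 !mul1r !divr1 !addr0.
rewrite bincoefS IHj !bincoefS.
have e1 : j.+1%:R = j%:R + 1 :> R by rewrite -addn1 natrD.
have e2 : j.+2%:R = j%:R + 1 + 1 :> R by rewrite -addn2 natrD; ring.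
have j0 := ler0n R j.
rewrite e2 e1; field; apply/andP; split; rewrite gt_eqF//; lra.
Qed.

(** A difference multiplies the generating function by 1 - z; here the kernel absorbs that
    factor. *)
Lemma conv_bincoef_diff b F n :
  conv (bincoef b) F n.+1 - conv (bincoef b) F n = conv (bincoef (b - 1)) F n.+1.
Proof.
rewrite /conv big_ord_recr/= [in RHS]big_ord_recr/= subnn !bincoef0 !mul1r.
rewrite addrAC; congr (_ + _); rewrite -sumrB; apply: eq_bigr => i _.
have lein : (i <= n)%N by rewrite -ltnS.
by rewrite subSn// bincoef_pred mulrBl.
Qed.

(** Here F absorbs the difference instead, which leaves a boundary term at F 0. *)
Lemma conv_shift_diff b F n :
  conv (bincoef b) F n.+1 - conv (bincoef b) F n =
  bincoef b n.+1 * F 0 + conv (bincoef b) (fun i => F i.+1 - F i) n.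
Proof.
rewrite {1}/conv big_ord_recl subn0 -addrA; congr (_ + _).
by rewrite /conv -sumrB; apply: eq_bigr => i _; rewrite mulrBr.
Qed.

(** The first factor 1 - nu is negative, and every later numerator is at least 2 - nu > 0. *)
Lemma bincoef_le0 nu j : 1 < nu < 2 -> bincoef (1 - nu) j.+1 <= 0.
Proof.
move=> /andP[nu1 nu2]; elim: j => [|j IHj].
  by rewrite bincoefS bincoef0 mul1r divr1 addr0 subr_le0 ltW.
rewrite bincoefS mulr_le0_ge0// divr_ge0// -natr1.
by have := ler0n R j; lra.
Qed.

Lemma conv_bincoef_monotone nu F : 1 < nu < 2 ->
  (forall n, 0 <= conv (bincoef (- nu)) F n.+2) ->
  (forall k : nat, nu / (k%:R + 2) * F 0 <= F 1) ->
  forall n, F n.+1 <= F n.+2.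
Proof.
move=> hnu hconv hF n; elim/ltn_ind: n => n IHn.
have := hconv n.
(* One difference is taken out of the kernel and moved onto F. *)
have -> : - nu = (1 - nu) - 1 by ring.
rewrite -conv_bincoef_diff conv_shift_diff /conv.
(* The newest increment, with coefficient e_0 = 1, and the oldest, F 1 - F 0, are split off; the
   induction hypothesis covers the increments left in [s]. *)
rewrite big_ord_recr/= subnn bincoef0 mul1r big_ord_recl/= subn0.
set s := \sum_(i < n) _.
have s0 : s <= 0.
  apply: sumr_le0 => i _; rewrite /bump/= add1n subSS.
  have -> : (n - i = (n - i).-1.+1)%N by rewrite prednK// subn_gt0.
  by rewrite mulr_le0_ge0 ?bincoef_le0// subr_ge0 IHn.
have e0 := bincoef_le0 nu n hnu.
(* As e_(n+2) = e_(n+1) (1 - nu / (n + 2)), the boundary term and the oldest increment combine to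
   e_(n+1) (F 1 - nu / (n + 2) F 0), so the hypothesis is used at k = n. *)
rewrite bincoefS.
have : 0 <= - bincoef (1 - nu) n.+1 * (F 1 - nu / (n%:R + 2) * F 0).
  by rewrite mulr_ge0 ?oppr_ge0// subr_ge0.
have n2 : (n%:R + 2 : R) != 0 by rewrite gt_eqF// ltr_wpDl.
have -> : (1 - nu + n.+1%:R) / n.+2%:R = 1 - nu / (n%:R + 2) :> R.
  have -> : n.+2%:R = n%:R + 2 :> R by rewrite -addn2 natrD.
  by rewrite -natr1; field.
lra.
Qed.

Lemma nabla_sum_conv (a b : R) (f : R -> R) k : 0 < b ->
  nabla_sum (a - 1) b f (a + k%:R) = conv (bincoef b) (fun i => f (a + i%:R)) k.
Proof.
move=> b0; rewrite /nabla_sum /sum_upto /conv.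
(* Starting from a - 1 makes s = a the first summation point, so there are k + 1 terms, as in
   [conv]. *)
have -> : a + k%:R - (a - 1) = k.+1%:R by rewrite -natr1; ring.
rewrite natrK mulr_sumr; apply: eq_bigr => i _.
have -> : a - 1 + i.+1%:R = a + i%:R by rewrite -natr1; ring.
rewrite mulrA bincoef_Gamma//; congr (_ * rising _ _ * _).
have leik : (i <= k)%N by rewrite -ltnS.
by rewrite /rho -natr1 natrB//; ring.
Qed.

(** Two nablas act on a sum of order 2 - nu > 0 and lower the kernel parameter to -nu. They reach
    back to a + m, still in the range of [nabla_sum_conv]. *)
Lemma nabla_diff_conv (a nu : R) (f : R -> R) m : 1 < nu < 2 ->
  nabla_diff (a - 1) nu f (a + m.+2%:R) =
  conv (bincoef (- nu)) (fun i => f (a + i%:R)) m.+2.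
Proof.
move=> /andP[nu1 nu2]; rewrite /nabla_diff.
have -> : Num.truncn nu = 1%N.
  by apply: truncn_def; rewrite ltW.
rewrite /= /nabla.
have -> : a + m.+2%:R - 1 = a + m.+1%:R by rewrite -(natr1 m.+1); ring.
have -> : a + m.+1%:R - 1 = a + m%:R by rewrite -(natr1 m); ring.
rewrite !nabla_sum_conv ?subr_gt0//.
rewrite !conv_bincoef_diff; congr (conv (bincoef _) _ _); ring.
Qed.

End binomial_convolution.

Theorem theorem2p5 (R : realType) (a nu : R) (f : R -> R)
  (hnu : 1 < nu < 2)
  (hdiff : forall t : R, NN (a + 2) t -> 0 <= nabla_diff (a - 1) nu f t)
  (hf : forall k : nat, f (a + 1) >= nu / (k%:R + 2) * f a) :
  forall t : R, NN (a + 2) t -> 0 <= nabla f t.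
Proof.
have aE m : a + 2 + m%:R = a + m.+2%:R by rewrite -addrA -natrD.
move=> _ [m _ <-]; rewrite /nabla aE.
have -> : a + m.+2%:R - 1 = a + m.+1%:R by rewrite -(natr1 m.+1); ring.
rewrite subr_ge0.
apply: (@conv_bincoef_monotone R nu (fun i => f (a + i%:R))) => // [n|k].
  by rewrite -nabla_diff_conv// hdiff//; exists n => //; rewrite aE.
by rewrite addr0.
Qed.
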